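(* Let $K$ be an algebraically closed field of characteristic $0$, and let $(V,\rho)$ be a strictly indecomposable representation of the braid group $B_3$ over $K$ with $\dim(V)=2$. Then $(V,\rho)$ is equivalent to a representation for which the matrices $A$ of $\rho(\sigma_1)$ and $B$ of $\rho(\sigma_2)$ are one of the following: (1) $A=\begin{pmatrix}\lambda_1&0\\0&\lambda_2\end{pmatrix}$, $B=\begin{pmatrix}\lambda_1&1\\0&\lambda_2\end{pmatrix}$, where $\lambda_1,\lambda_2\in K^\times$ and $\lambda_2=\lambda_1e^{\pm\pi i/3}$; (2) $A=B=\begin{pmatrix}\lambda&1\\0&\lambda\end{pmatrix}$, where $\lambda\in K^\times$.
   Context: The braid group $B_3$ is the group generated by $\sigma_1,\sigma_2$ subject to the relation $\sigma_1\sigma_2\sigma_1=\sigma_2\sigma_1\sigma_2$. A representation is decomposable if it is the direct sum of two proper non-zero invariant subspaces, and indecomposable otherwise; it is irreducible if its only invariant subspaces are $0$ and $V$. A representation is strictly indecomposable if it is indecomposable but not irreducible. Equivalence of representations means simultaneous conjugation of the matrices $A,B$ by an invertible matrix over $K$. The symbols $e^{\pm\pi i/3}$ denote the two primitive sixth roots of unity in $K$ (so $\lambda_2=\lambda_1e^{\pm\pi i/3}$ means $\lambda_1^2-\lambda_1\lambda_2+\lambda_2^2=0$), and either choice of sign is allowed. *)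

(* Defs.v *)
From HB Require Import structures.
From mathcomp Require Import all_boot all_algebra.
From mathcomp Require Import boolp.

Set Implicit Arguments.
Unset Strict Implicit.
Unset Printing Implicit Defensive.

Import GRing.Theory.

Local Open Scope quotient_scope.

(* B_3 is built as the quotient of the words in the letters s_i^{+1}, s_i^{-1}
   (i = 0, 1) by the congruence generated by free cancellation and the braid
   relation.  In the letter (i, b), b = true stands for the inverse of s_i. *)
Notation letter := ('I_2 * bool)%type.
Notation word := (seq letter).

Definition s1 : letter := (ord0, false).
Definition s2 : letter := (ord_max, false).

Inductive word_eq : word -> word -> Prop :=
| weq_refl u : word_eq u u
| weq_sym u v : word_eq u v -> word_eq v u
| weq_trans u v w : word_eq u v -> word_eq v w -> word_eq u w
| weq_cat u u' v v' : word_eq u u' -> word_eq v v' -> word_eq (u ++ v) (u' ++ v')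
| weq_cancel i b : word_eq [:: (i, b); (i, ~~ b)] [::]
| weq_braid : word_eq [:: s1; s2; s1] [:: s2; s1; s2].

Definition word_eqb : rel word := fun u v => `[< word_eq u v >].

Lemma word_eqb_refl : reflexive word_eqb.
Proof. by move=> u; apply/asboolP; exact: weq_refl. Qed.

Lemma word_eqb_sym : symmetric word_eqb.
Proof.
by move=> u v; apply/idP/idP => /asboolP H; apply/asboolP; exact: weq_sym.
Qed.

Lemma word_eqb_trans : transitive word_eqb.
Proof.
move=> v u w /asboolP H1 /asboolP H2; apply/asboolP; exact: weq_trans H1 H2.
Qed.

Canonical word_equiv := EquivRel word_eqb word_eqb_refl word_eqb_sym word_eqb_trans.

Definition B3 : Type := {eq_quot word_equiv}.
HB.instance Definition _ := Choice.on B3.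
HB.instance Definition _ := EqQuotient.on B3.

Definition B3_of_word (u : word) : B3 := \pi_B3 u.

Definition inv_word (u : word) : word := rev [seq (x.1, ~~ x.2) | x <- u].

Definition B3_one : B3 := B3_of_word [::].
Definition B3_mul (x y : B3) : B3 := B3_of_word (repr x ++ repr y).
Definition B3_inv (x : B3) : B3 := B3_of_word (inv_word (repr x)).

Lemma B3_of_wordP (u v : word) : B3_of_word u = B3_of_word v <-> word_eq u v.
Proof.
split=> [/eqP|H]; first by rewrite /B3_of_word eqmodE => /asboolP.
by apply/eqP; rewrite /B3_of_word eqmodE; apply/asboolP.
Qed.

Lemma repr_B3_of_word (u : word) : word_eq (repr (B3_of_word u)) u.
Proof. by apply/B3_of_wordP; rewrite /B3_of_word reprK. Qed.

Lemma B3_ind (P : B3 -> Prop) : (forall u, P (B3_of_word u)) -> forall x, P x.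
Proof. by move=> H x; rewrite -[x]reprK; apply: H. Qed.

Lemma inv_word_cat (u v : word) : inv_word (u ++ v) = inv_word v ++ inv_word u.
Proof. by rewrite /inv_word map_cat rev_cat. Qed.

Lemma inv_wordK : involutive inv_word.
Proof.
move=> u; rewrite /inv_word map_rev revK -map_comp -[RHS]map_id.
by apply: eq_map => -[i b] /=; rewrite negbK.
Qed.

Lemma word_mulV (u : word) : word_eq (u ++ inv_word u) [::].
Proof.
elim: u => [|[i b] u IH]; first exact: weq_refl.
rewrite -cat1s inv_word_cat catA -(catA [:: _]).
apply: (@weq_trans _ ([:: (i, b)] ++ [::] ++ inv_word [:: (i, b)])).
  by rewrite -catA; do 2![apply: weq_cat => //; try exact: weq_refl].
exact: weq_cancel.
Qed.

Lemma word_Vmul (u : word) : word_eq (inv_word u ++ u) [::].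
Proof. by rewrite -{2}(inv_wordK u); apply: word_mulV. Qed.

Lemma word_inv_eq (u v : word) : word_eq u v -> word_eq (inv_word u) (inv_word v).
Proof.
move=> H; apply: (@weq_trans _ (inv_word u ++ (v ++ inv_word v))).
  rewrite -{1}(cats0 (inv_word u)); apply: weq_cat; first exact: weq_refl.
  exact/weq_sym/word_mulV.
rewrite catA -{2}(cat0s (inv_word v)); apply: weq_cat; last exact: weq_refl.
apply: weq_trans (word_Vmul u).
by apply: weq_cat; [exact: weq_refl | exact: weq_sym].
Qed.

Lemma B3_mulE (u v : word) :
  B3_mul (B3_of_word u) (B3_of_word v) = B3_of_word (u ++ v).
Proof. by apply/B3_of_wordP; apply: weq_cat; exact: repr_B3_of_word. Qed.

Lemma B3_invE (u : word) : B3_inv (B3_of_word u) = B3_of_word (inv_word u).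
Proof. by apply/B3_of_wordP; apply: word_inv_eq; exact: repr_B3_of_word. Qed.

Lemma B3_mulA : associative B3_mul.
Proof.
by elim/B3_ind=> u; elim/B3_ind=> v; elim/B3_ind=> w; rewrite !B3_mulE catA.
Qed.

Lemma B3_mul1 : left_id B3_one B3_mul.
Proof. by elim/B3_ind=> u; rewrite B3_mulE. Qed.

Lemma B3_mulr1 : right_id B3_one B3_mul.
Proof. by elim/B3_ind=> u; rewrite B3_mulE cats0. Qed.

Lemma B3_mulV : left_inverse B3_one B3_inv B3_mul.
Proof.
by elim/B3_ind=> u; rewrite B3_invE B3_mulE; apply/B3_of_wordP/word_Vmul.
Qed.

Lemma B3_mulrV : right_inverse B3_one B3_inv B3_mul.
Proof.
by elim/B3_ind=> u; rewrite B3_invE B3_mulE; apply/B3_of_wordP/word_mulV.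
Qed.

HB.instance Definition _ :=
  isGroup.Build B3 B3_mulA B3_mul1 B3_mulr1 B3_mulV B3_mulrV.

Lemma B3_mulgE (u v : word) :
  (B3_of_word u * B3_of_word v)%g = B3_of_word (u ++ v).
Proof. exact: B3_mulE. Qed.

Definition sigma1 : B3 := B3_of_word [:: s1].
Definition sigma2 : B3 := B3_of_word [:: s2].

Lemma B3_braid : (sigma1 * sigma2 * sigma1)%g = (sigma2 * sigma1 * sigma2)%g.
Proof. by rewrite /sigma1 /sigma2 !B3_mulgE; apply/B3_of_wordP; exact: weq_braid. Qed.

(* B3_lift and B3_gen are the universal property of the presentation
   <sigma1, sigma2 | sigma1 sigma2 sigma1 = sigma2 sigma1 sigma2>. *)
Lemma B3_lift (H : groupType) (a b : H) : (a * b * a = b * a * b)%g ->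
  exists f : B3 -> H, [/\ monoid.monoid_morphism f, f sigma1 = a & f sigma2 = b].
Proof.
move=> ab.
pose g (x : letter) : H :=
  let y := if x.1 == ord0 then a else b in if x.2 then (y^-1)%g else y.
pose h (u : word) : H := foldr (fun x y => g x * y)%g 1%g u.
have hM u v : h (u ++ v) = (h u * h v)%g.
  by elim: u => [|x u IH] /=; rewrite ?mul1g // IH mulgA.
have hP u v : word_eq u v -> h u = h v.
  elim=> {u v} //.
  - by move=> u v w _ -> _ ->.
  - by move=> u u' v v' _ Hu _ Hv; rewrite !hM Hu Hv.
  - by move=> i [] /=; rewrite /g /= mulg1 ?mulVg ?mulgV.
  - by rewrite /= /g /= !mulg1 !mulgA.
have hE u : h (repr (B3_of_word u)) = h u by apply: hP; exact: repr_B3_of_word.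
exists (fun x => h (repr x)); split.
- split; first exact: hE.
  by elim/B3_ind=> u; elim/B3_ind=> v; rewrite B3_mulgE !hE hM.
- by rewrite hE /= /g /= mulg1.
- by rewrite hE /= /g /= mulg1.
Qed.

Lemma B3_gen (H : groupType) (f f' : B3 -> H) :
  monoid.monoid_morphism f -> monoid.monoid_morphism f' ->
  f sigma1 = f' sigma1 -> f sigma2 = f' sigma2 -> f =1 f'.
Proof.
move=> [f1 fM] [g1 gM] e1 e2.
have fs i : f (B3_of_word [:: (i, false)]) = f' (B3_of_word [:: (i, false)]).
  case: i => [[|[|//]]] p.
    by rewrite (_ : Ordinal p = ord0) //; exact: val_inj.
  by rewrite (_ : Ordinal p = ord_max) //; exact: val_inj.
have inv (k : B3 -> H) i : (k 1 = 1)%g -> {morph k : x y / (x * y)%g} ->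
    k (B3_of_word [:: (i, true)]) = ((k (B3_of_word [:: (i, false)]))^-1)%g.
  move=> k1 kM; apply/eqP; rewrite -mulg_eq1 -kM B3_mulgE; apply/eqP.
  by rewrite -k1; congr k; apply/B3_of_wordP; exact: weq_cancel.
elim/B3_ind; elim=> [|[i c] u IH]; first by rewrite f1 g1.
rewrite -cat1s -B3_mulgE fM gM IH; congr (_ * _)%g.
by case: c => //; rewrite !inv // fs.
Qed.

Local Open Scope ring_scope.

Section Representations.

Variables (G : groupType) (K : fieldType).

(* rep_fun is a homomorphism G -> GL(V): invertibility of each rep_fun g is
   automatic. *)
Record representation (V : vectType K) := Representation {
  rep_fun :> G -> 'End(V);
  rep_fun1 : rep_fun 1%g = \1%VF;
  rep_funM : forall g h : G, rep_fun (g * h)%g = (rep_fun g \o rep_fun h)%VF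
}.

Variables (V : vectType K) (rho : representation V).

Definition invariant (U : {vspace V}) : Prop :=
  forall g : G, (rho g @: U <= U)%VS.

Definition irreducible : Prop :=
  forall U : {vspace V}, invariant U -> U = 0%VS \/ U = fullv.

Definition decomposable : Prop :=
  exists U W : {vspace V},
    [/\ invariant U, invariant W,
        [/\ U <> 0%VS, U <> fullv, W <> 0%VS & W <> fullv],
        (U + W)%VS = fullv & directv (U + W)].

Definition indecomposable : Prop := ~ decomposable.

Definition strictly_indecomposable : Prop := indecomposable /\ ~ irreducible.

End Representations.

Section Matrices.

Variable K : fieldType.

Definition matrix_in (V : vectType K) n (e : n.-tuple V) (f : 'End(V)) : 'M[K]_n :=
  \matrix_(i, j) coord e i (f e`_j).

(* Equivalence of representations of B_3: in any bases, the matrices of sigma1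
   and sigma2 are simultaneously conjugate. *)
Definition B3_equivalent (V W : vectType K)
    (rho : representation B3 V) (rho' : representation B3 W) : Prop :=
  \dim {:V} = \dim {:W} /\
  forall n (e : n.-tuple V) (e' : n.-tuple W),
    basis_of fullv e -> basis_of fullv e' ->
    exists P : 'M[K]_n, [/\ P \in unitmx,
      matrix_in e' (rho' sigma1) = invmx P *m matrix_in e (rho sigma1) *m P
    & matrix_in e' (rho' sigma2) = invmx P *m matrix_in e (rho sigma2) *m P].

Definition mx22 (a b c d : K) : 'M[K]_2 :=
  \matrix_(i, j) (if i == ord0 then if j == ord0 then a else b
                  else if j == ord0 then c else d).

End Matrices.

(* Main.v *)
Require Import Defs.
From mathcomp Require Import all_boot all_algebra.
From mathcomp Require Import boolp ring.

Set Implicit Arguments.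
Unset Strict Implicit.
Unset Printing Implicit Defensive.

Import GRing.Theory passmx.
Local Open Scope ring_scope.

(** A reducible plane [V] contains an invariant line [<[v]>].  Completing [v]
    to a basis [(v, w)], the generators become the upper triangular matrices
    with first rows [(l1, a)], [(m1, b)] and lower right entries [l2], [m2].
    The diagonal of the braid relation gives [m1 = l1] and [m2 = l2], since
    all these are nonzero, and its corner entry gives
    [(a - b) * (l1 ^+ 2 - l1 * l2 + l2 ^+ 2) = 0]
    (lemma [braid_triangular]).

    - If [a = b], the two generators act by the same map.  It is not
      diagonalizable, for a common eigenbasis would decompose [V]
      (lemma [eigenbasis_decomposable]); hence [l1 = l2] and [a != 0], and in
      the basis [(a *: v, w)] both generators are the Jordan block.
    - If [a != b], then [z := l2 / l1] satisfies [z ^+ 2 - z + 1 = 0], so it is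
      a primitive sixth root of unity in characteristic [0]
      (lemma [prim6_rootP]).  In particular [l1 != l2], so [w] can be replaced
      by an eigenvector [w + k *: v] of [sigma1] for [l2]; then [sigma2] sends
      it to itself times [l2] plus [(b - a) *: v], and rescaling [v] by [b - a]
      gives the first normal form.

    The representation itself, read in the new basis, is the required
    equivalent representation, matrices in different bases being conjugate
    (lemma [B3_equivalent_refl]). *)

(** * Invariant subspaces of representations of the braid group *)

Lemma B3_gen_ind (P : B3 -> Prop) :
  P 1%g -> P sigma1 -> P sigma2 ->
  (forall x y, P x -> P y -> P (x * y)%g) -> (forall x, P x -> P x^-1%g) ->
  forall x, P x.
Proof.
move=> P1 Ps1 Ps2 PM PV; elim/B3_ind; elim=> [|[i c] u IH]; first exact: P1.
rewrite -cat1s -B3_mulgE; apply: PM IH.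
have Pi : P (B3_of_word [:: (i, false)]).
  case: i => [[|[|//]]] p.
    by rewrite (_ : Ordinal p = ord0) //; exact: val_inj.
  by rewrite (_ : Ordinal p = ord_max) //; exact: val_inj.
case: c => //.
have -> : B3_of_word [:: (i, true)] = B3_inv (B3_of_word [:: (i, false)]).
  by rewrite B3_invE.
exact: PV.
Qed.

Section Representations.

Variables (K : fieldType) (V : vectType K).

Section Group.

Variables (G : groupType) (rho : representation G V).

Lemma rep_funK (g : G) : cancel (rho g) (rho g^-1%g).
Proof. by move=> v; rewrite -comp_lfunE -rep_funM mulVg rep_fun1 id_lfunE. Qed.

Lemma rep_fun_eigenvalue_neq0 (g : G) (v : V) (l : K) :
  v != 0 -> rho g v = l *: v -> l != 0.
Proof.
move=> v0 gv; apply: contra_neq v0 => l0.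
by rewrite -[v](rep_funK g) gv l0 scale0r linear0.
Qed.

(** Since [rho g] is injective, a stable subspace is mapped onto itself by
    [rho g], hence is also stable under the inverse. *)
Lemma rep_fun_stableV (g : G) (U : {vspace V}) :
  (rho g @: U <= U)%VS -> (rho g^-1%g @: U <= U)%VS.
Proof.
move=> sU.
have ker0 : lker (rho g) == 0%VS by apply/lker0P/(can_inj (rep_funK g)).
have gU : (rho g @: U = U)%VS.
  by apply/eqP; rewrite eqEdim sU limg_dim_eq ?leqnn // (eqP ker0) capv0.
by rewrite -{1}gU -limg_comp -rep_funM mulVg rep_fun1 lim1g.
Qed.

End Group.

Variable rho : representation B3 V.

Lemma B3_invariant (U : {vspace V}) :
  (rho sigma1 @: U <= U)%VS -> (rho sigma2 @: U <= U)%VS -> Defs.invariant rho U.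
Proof.
move=> U1 U2; elim/B3_gen_ind => [|//|//|g h gU hU|g].
- by rewrite rep_fun1 lim1g.
- rewrite rep_funM limg_comp; exact: subv_trans (limgS _ hU) gU.
- exact: rep_fun_stableV.
Qed.

Lemma B3_invariant_line (v : V) (l m : K) :
  rho sigma1 v = l *: v -> rho sigma2 v = m *: v -> Defs.invariant rho <[v]>%VS.
Proof.
by move=> v1 v2; apply: B3_invariant; rewrite limg_line ?v1 ?v2 -memvE
  memvZ ?memv_line.
Qed.

(** * Bases of a plane *)

(** The sequence [v], [w], in this order, is a basis of the whole space. *)
Definition pair_basis (v w : V) : Prop := basis_of fullv [:: v; w].

Hypothesis dimV : \dim {:V} = 2%N.

Lemma pair_basisP (v w : V) :
  pair_basis v w <-> v != 0 /\ w \notin <[v]>%VS.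
Proof.
rewrite /pair_basis basisEfree dimV subvf leqnn !andbT.
rewrite (perm_free (_ : perm_eq _ [:: w; v])); last by rewrite (perm_catC [:: v]).
rewrite free_cons seq1_free span_seq1 andbC.
by split=> [/andP|/andP].
Qed.

Lemma pair_basisZD (v w : V) (c k : K) :
  c != 0 -> pair_basis v w -> pair_basis (c *: v) (w + k *: v).
Proof.
move=> c0 /pair_basisP[v0 wv]; apply/pair_basisP; split.
  by rewrite scaler_eq0 negb_or c0.
have kv : k *: v \in <[v]>%VS by rewrite memvZ ?memv_line.
apply: contra wv => /vlineP[x E]; apply/vlineP; exists (x * c - k).
by rewrite scalerBl -scalerA -E addrK.
Qed.

Lemma pair_basis_decomp (v w u : V) : pair_basis v w ->
  exists x y : K, u = x *: v + y *: w.
Proof.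
move=> bvw; have := memvf u; rewrite -(span_basis bvw) span_cons span_seq1.
by case/memv_addP=> _ /vlineP[x ->] [_ /vlineP[y ->] ->]; exists x, y.
Qed.

Lemma pair_basis_inj (v w : V) (x y x' y' : K) : pair_basis v w ->
  x *: v + y *: w = x' *: v + y' *: w -> x = x' /\ y = y'.
Proof.
move=> /pair_basisP[v0 wv] E.
have Ew : (y - y') *: w = (x' - x) *: v.
  apply/eqP; rewrite -subr_eq0 -[x' - x]opprB scaleNr opprK addrC !scalerBl.
  by rewrite addrACA -opprD E subrr.
have yy : y = y'.
  apply/eqP; rewrite -subr_eq0; apply: contraNT wv => d0.
  by rewrite -[w]scale1r -(mulVf d0) -scalerA Ew !memvZ ?memv_line.
split=> //; apply/esym/eqP; rewrite -subr_eq0.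
by move: Ew; rewrite yy subrr scale0r => /esym/eqP; rewrite scaler_eq0 (negPf v0) orbF.
Qed.

(** The columns of [matrix_in] are the coordinates of the images of the basis
    vectors. *)
Lemma matrix_in_pair (v w : V) (f : 'End(V)) (a b c d : K) :
  pair_basis v w -> f v = a *: v + c *: w -> f w = b *: v + d *: w ->
  matrix_in [tuple v; w] f = mx22 a b c d.
Proof.
move=> bvw fv fw; pose e := [tuple v; w].
have fr : free e := basis_free bvw.
have cv i : coord e i v = (i == ord0)%:R.
  by have := coord_free ord0 i fr; rewrite /= eq_sym.
have cw i : coord e i w = (i == ord_max)%:R.
  by have := coord_free ord_max i fr; rewrite /= eq_sym.
have o2 (i : 'I_2) : i = ord0 \/ i = ord_max.
  by case: i => [[|[|//]]] p; [left|right]; exact: val_inj.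
apply/matrixP=> i j; rewrite !mxE.
case: (o2 j) => -> /=; rewrite ?fv ?fw linearD !linearZ /= cv cw.
  by case: (o2 i) => -> /=; rewrite ?mulr1 ?mulr0 ?addr0 ?add0r.
by case: (o2 i) => -> /=; rewrite ?mulr1 ?mulr0 ?addr0 ?add0r.
Qed.

Lemma proper_subspace_line (U : {vspace V}) : U <> 0%VS -> U <> fullv ->
  exists2 v, v != 0 & U = <[v]>%VS.
Proof.
move=> /eqP U0 /eqP U1; have dU : \dim U = 1%N.
  apply/eqP; rewrite eqn_leq lt0n dimv_eq0 U0 andbT -ltnS -dimV.
  by rewrite ltn_neqAle dimvS ?subvf // andbT; apply: contra U1 => dU;
     rewrite eqEdim subvf (eqP dU) leqnn.
exists (vpick U); first by rewrite vpick0.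
apply/esym/eqP; rewrite eqEdim -memvE memv_pick dU dim_vline vpick0 U0.
by [].
Qed.

Lemma line_complement (v : V) : v != 0 -> exists w, pair_basis v w.
Proof.
move=> v0; have [w _ wv] : exists2 w, w \in {:V}%VS & w \notin <[v]>%VS.
  apply/subvPn; apply: contra_eqN dimV => /dimvS.
  by rewrite dim_vline v0; case: (\dim _) => [|[|]].
by exists w; apply/pair_basisP.
Qed.

(** A basis of common eigenvectors exhibits [rho] as a sum of two lines. *)
Lemma eigenbasis_decomposable (v w : V) (l l' m m' : K) :
  pair_basis v w -> rho sigma1 v = l *: v -> rho sigma2 v = l' *: v ->
  rho sigma1 w = m *: w -> rho sigma2 w = m' *: w -> decomposable rho.
Proof.
move=> bvw v1 v2 w1 w2; have /pair_basisP[v0 wv] := bvw.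
have w0 : w != 0 by apply: contraNneq wv => ->; exact: mem0v.
have sVW : (<[v]> + <[w]>)%VS = fullv.
  by rewrite -(span_basis bvw) span_cons span_seq1.
have line_proper (u : V) : u != 0 -> <[u]>%VS <> 0%VS /\ <[u]>%VS <> fullv.
  move=> u0; split=> [/eqP|E]; first by rewrite -dimv_eq0 dim_vline u0.
  by have := dimV; rewrite -E dim_vline u0.
have [? ?] := line_proper v v0; have [? ?] := line_proper w w0.
exists <[v]>%VS, <[w]>%VS; split=> //; [exact: B3_invariant_line v1 v2|
  exact: B3_invariant_line w1 w2|].
by rewrite directvEgeq /= sVW dimV !dim_vline v0 w0.
Qed.

(** * The braid relation for triangular matrices *)

Lemma braid_triangular (v w : V) (l1 m1 l2 m2 a b : K) :
  pair_basis v w ->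
  rho sigma1 v = l1 *: v -> rho sigma2 v = m1 *: v ->
  rho sigma1 w = a *: v + l2 *: w -> rho sigma2 w = b *: v + m2 *: w ->
  [/\ l1 != 0, l2 != 0, m1 = l1, m2 = l2
    & (a - b) * (l1 ^+ 2 - l1 * l2 + l2 ^+ 2) = 0].
Proof.
move=> bvw v1 v2 w1 w2; have /pair_basisP[v0 wv] := bvw.
have actE (g : B3) (l c d x y : K) : rho g v = l *: v ->
    rho g w = c *: v + d *: w ->
    rho g (x *: v + y *: w) = (x * l + y * c) *: v + (y * d) *: w.
  move=> gv gw; rewrite linearD !linearZ /= gv gw scalerDr !scalerA.
  by rewrite addrA -scalerDl.
have diag_neq0 (g : B3) (l c d : K) : rho g v = l *: v ->
    rho g w = c *: v + d *: w -> l != 0 /\ d != 0.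
  move=> gv gw; have l0 := rep_fun_eigenvalue_neq0 v0 gv; split=> //.
  (* If [d = 0], then [- c *: v + l *: w] is a nonzero vector killed by the
     invertible map [rho g]. *)
  apply/eqP=> d0; have : rho g (- c *: v + l *: w) = rho g (0 *: v + 0 *: w).
    by rewrite !(actE _ _ _ _ _ _ gv gw) d0 !mulr0 !mul0r mulNr mulrC addNr addr0.
  move/(can_inj (rep_funK rho g))/(pair_basis_inj bvw) => [_ l00].
  by rewrite l00 eqxx in l0.
have [l10 l20] := diag_neq0 _ _ _ _ v1 w1.
have [m10 m20] := diag_neq0 _ _ _ _ v2 w2.
have br u : rho sigma1 (rho sigma2 (rho sigma1 u))
          = rho sigma2 (rho sigma1 (rho sigma2 u)).
  by rewrite -!comp_lfunE -!rep_funM B3_braid.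
have m1E : m1 = l1.
  have := br (1 *: v + 0 *: w).
  rewrite !(actE _ _ _ _ _ _ v1 w1, actE _ _ _ _ _ _ v2 w2).
  rewrite !mul0r !addr0 mul1r => /(pair_basis_inj bvw)[E _].
  by apply: (mulfI (mulf_neq0 l10 m10)); rewrite E; ring.
have := br (0 *: v + 1 *: w).
rewrite !(actE _ _ _ _ _ _ v1 w1, actE _ _ _ _ _ _ v2 w2).
case/(pair_basis_inj bvw) => Ec Ed.
have m2E : m2 = l2.
  apply: (mulfI (mulf_neq0 l20 m20)); rewrite mul1r in Ed.
  by rewrite Ed; ring.
split=> //; move: Ec; rewrite m1E m2E => /eqP; rewrite -subr_eq0 => /eqP Ec.
by rewrite -[RHS]Ec; ring.
Qed.

End Representations.

(** * Sixth roots of unity *)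

Lemma prim6_rootP (K : fieldType) (z : K) : [pchar K] =i pred0 ->
  z ^+ 2 - z + 1 = 0 -> 6.-primitive_root z.
Proof.
move=> ch0 Ez; have [two0 three0] : (2%:R : K) != 0 /\ (3%:R : K) != 0.
  by split; rewrite ((pcharf0P K).1 ch0).
have z2 : z ^+ 2 = z - 1.
  by apply/eqP; rewrite -subr_eq0 opprB addrCA addrC Ez.
have z3 : z ^+ 3 = -1 by rewrite exprS z2 mulrBr mulr1 -expr2 z2; ring.
have z6 : z ^+ 6 = 1 by rewrite (exprM z 3 2) z3 sqrrN expr1n.
(* The order of [z] divides 6; it is neither 1 nor 2 since 1 and 3 are
   nonzero, and not 3 since 2 is nonzero. *)
have [m mz] := @prim_order_exists _ 6 z isT z6; rewrite dvdn_divisors //.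
rewrite (_ : divisors 6 = [:: 1; 2; 3; 6]%N) // !inE.
case/or4P=> /eqP mE; rewrite mE in mz; last by [].
- case/negP: (oner_neq0 K); rewrite -[X in _ == X]Ez.
  by have := prim_expr_order mz; rewrite expr1 => ->; rewrite expr1n subrr add0r.
- case/negP: three0; have := prim_expr_order mz; rewrite z2 => /eqP.
  rewrite subr_eq => /eqP zE; move: Ez; rewrite zE => <-.
  by apply/eqP; ring.
- case/negP: two0; have := prim_expr_order mz; rewrite z3 => /eqP.
  by rewrite eq_sym -subr_eq0 opprK.
Qed.

(** * Change of basis *)

(** The relation quantifies over two unrelated bases, so reflexivity says that
    changing the basis conjugates the matrices.  As [matrix_in] has images in
    columns and [mxof] in rows, the two differ by a transposition. *)
Lemma B3_equivalent_refl (K : fieldType) (V : vectType K)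
  (rho : representation B3 V) : B3_equivalent rho rho.
Proof.
split=> // n e e' be be'; have dn := size_basis be.
move: e e' be be'; rewrite -dn => {n dn} e e' be be'.
have matE (u : (\dim {:V}).-tuple V) (f : 'End(V)) :
    matrix_in u f = (mxof u u f)^T.
  by apply/matrixP=> i j; rewrite !mxE /= vecof_delta.
have mulP (u u' : (\dim {:V}).-tuple V) :
    basis_of fullv u -> basis_of fullv u' ->
    (mxof u u' \1)^T *m (mxof u' u \1)^T = 1%:M.
  move=> bu bu'; rewrite -trmx_mul -(mxof_comp _ _ bu) comp_lfun1l.
  by rewrite (mxof1 (basis_free bu')) trmx1.
have [unitP invP] : (mxof e' e \1)^T \in unitmx
    /\ invmx (mxof e' e \1)^T = (mxof e e' \1)^T.
  have E := mulP _ _ be be'; have [_ uP] := mulmx1_unit E.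
  by split=> //; rewrite -[RHS]mulmx1 -(mulmxV uP) mulmxA E mul1mx.
have conj f : matrix_in e' f
    = invmx (mxof e' e \1)^T *m matrix_in e f *m (mxof e' e \1)^T.
  rewrite invP !matE -!trmx_mul; congr (_^T).
  by rewrite -mxof_comp // -mxof_comp // comp_lfun1l comp_lfun1r.
by exists (mxof e' e \1)^T; rewrite -!conj.
Qed.

(** * The classification *)

Theorem theorem2 (K : closedFieldType) (V : vectType K)
    (rho : representation B3 V) :
  [pchar K] =i pred0 ->
  \dim {:V} = 2%N ->
  strictly_indecomposable rho ->
  exists (W : vectType K) (rho' : representation B3 W) (e : 2.-tuple W)
         (A B : 'M[K]_2),
    [/\ B3_equivalent rho rho', basis_of {:W} e,
        A = matrix_in e (rho' sigma1), B = matrix_in e (rho' sigma2)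
      & (exists l1 l2 z : K,
           [/\ l1 != 0, l2 != 0, 6.-primitive_root z /\ l2 = l1 * z,
               A = mx22 l1 0 0 l2 & B = mx22 l1 1 0 l2])
        \/ (exists l : K,
           [/\ l != 0, A = mx22 l 1 0 l & B = mx22 l 1 0 l])].
Proof.
move=> ch0 dimV [indec red].
have [v v0 inv_v] : exists2 v, v != 0 & Defs.invariant rho <[v]>%VS.
  apply: contrapT => noline; apply: red => U invU.
  have [->|U0] := eqVneq U 0%VS; first by left.
  have [->|U1] := eqVneq U fullv; first by right.
  have [v v0 UE] := proper_subspace_line dimV (elimN eqP U0) (elimN eqP U1).
  by case: noline; exists v; rewrite -?UE.
have [w bvw] := line_complement dimV v0.
have eigen_v g : exists l, rho g v = l *: v.
  by apply/vlineP; rewrite memvE -limg_line.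
have [[l1 v1] [m1 v2]] := (eigen_v sigma1, eigen_v sigma2).
have [a [l2 w1]] := pair_basis_decomp (rho sigma1 w) bvw.
have [b [m2 w2]] := pair_basis_decomp (rho sigma2 w) bvw.
have [l10 l20 m1E m2E braidE] := braid_triangular dimV bvw v1 v2 w1 w2.
rewrite {m1}m1E in v2; rewrite {m2}m2E in w2.
(* The coefficient is chosen to make [w + a / (l2 - l1) *: v] an eigenvector
   of [sigma1], which is the case [c = a]. *)
have w_eigen (g : B3) (c : K) : l1 != l2 -> rho g v = l1 *: v ->
    rho g w = c *: v + l2 *: w ->
    rho g (w + (a / (l2 - l1)) *: v)
    = (c - a) *: v + l2 *: (w + (a / (l2 - l1)) *: v).
  move=> l12 gv gw; rewrite linearD linearZ /= gv gw scalerDr !scalerA.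
  rewrite addrAC -scalerDl [_ *: w + _]addrC addrA -scalerDl.
  congr (_ *: _ + _).
  by field; rewrite subr_eq0 eq_sym.
have [abE|ab] := eqVneq a b; last first.
  have c0 : b - a != 0 by rewrite subr_eq0 eq_sym.
  have Ez : (l2 / l1) ^+ 2 - l2 / l1 + 1 = 0.
    move/eqP: braidE; rewrite mulf_eq0 subr_eq0 (negPf ab) => /eqP E.
    transitivity ((l1 ^+ 2 - l1 * l2 + l2 ^+ 2) / l1 ^+ 2); first by field.
    by rewrite E mul0r.
  have l12 : l1 != l2.
    apply: contra_eqN Ez => /eqP <-.
    by rewrite divff // expr1n subrr add0r oner_neq0.
  pose v' := (b - a) *: v; pose w' := w + (a / (l2 - l1)) *: v.
  have bvw' : pair_basis v' w' by exact: pair_basisZD.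
  have v1' : rho sigma1 v' = l1 *: v' + 0 *: w'.
    by rewrite linearZ /= v1 scale0r addr0 !scalerA mulrC.
  have v2' : rho sigma2 v' = l1 *: v' + 0 *: w'.
    by rewrite linearZ /= v2 scale0r addr0 !scalerA mulrC.
  have w1' : rho sigma1 w' = 0 *: v' + l2 *: w'.
    by rewrite (w_eigen _ _ l12 v1 w1) subrr !scale0r.
  have w2' : rho sigma2 w' = 1 *: v' + l2 *: w'.
    by rewrite (w_eigen _ _ l12 v2 w2) scale1r.
  exists V, rho, [tuple v'; w'], (mx22 l1 0 0 l2), (mx22 l1 1 0 l2).
  rewrite (matrix_in_pair bvw' v1' w1') (matrix_in_pair bvw' v2' w2').
  split=> //; first exact: B3_equivalent_refl.
  left; exists l1, l2, (l2 / l1); split=> //; split; first exact: prim6_rootP.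
  by rewrite mulrCA divff ?mulr1.
have l12 : l1 = l2.
  apply: contra_notP indec => /eqP l12.
  have bvw' := pair_basisZD dimV (a / (l2 - l1)) (oner_neq0 _) bvw.
  rewrite scale1r in bvw'.
  apply: (eigenbasis_decomposable dimV bvw' v1 v2).
    by rewrite (w_eigen _ _ l12 v1 w1) subrr scale0r add0r.
  by rewrite (w_eigen _ _ l12 v2 w2) -abE subrr scale0r add0r.
have a0 : a != 0.
  apply/eqP=> a0; apply: indec; rewrite -abE a0 scale0r add0r in w2.
  rewrite a0 scale0r add0r in w1.
  exact: (eigenbasis_decomposable dimV bvw v1 v2 w1 w2).
have bvw' : pair_basis (a *: v) w.
  by rewrite -[w]addr0 -(scale0r v); exact: pair_basisZD.
have v1' : rho sigma1 (a *: v) = l1 *: (a *: v) + 0 *: w.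
  by rewrite linearZ /= v1 scale0r addr0 !scalerA mulrC.
have v2' : rho sigma2 (a *: v) = l1 *: (a *: v) + 0 *: w.
  by rewrite linearZ /= v2 scale0r addr0 !scalerA mulrC.
rewrite -l12 -[a *: v]scale1r in w1; rewrite -l12 -abE -[a *: v]scale1r in w2.
exists V, rho, [tuple a *: v; w], (mx22 l1 1 0 l1), (mx22 l1 1 0 l1).
rewrite (matrix_in_pair bvw' v1' w1) (matrix_in_pair bvw' v2' w2).
split=> //; first exact: B3_equivalent_refl.
by right; exists l1.
Qed.
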